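(* Let $\{\mathbb{R}^3;\, w_n^{rs},\ r,s\in\{1,2\},\ n=1,\dots,K^{rs}\}$ be the generalized graph-directed iterated function system associated with the generalized data sets $\mathcal{D}^1,\mathcal{D}^2$, as defined in the context, where $|\alpha_n^{rs}|<1$, $|\gamma_n^{rs}|<1$ and $|\beta_n^{rs}|+|\gamma_n^{rs}|<1$ for all $r,s\in\{1,2\}$ and $n=1,\dots,K^{rs}$. Let $G^1,G^2\subset\mathbb{R}^3$ be its attractors, i.e. nonempty compact sets with $$G^r=\bigcup_{s=1}^{2}\bigcup_{n=1}^{K^{rs}}w_n^{rs}(G^s),\qquad r=1,2.$$ Then for each $r\in\{1,2\}$, $G^r$ is the graph of a continuous vector-valued function $f^r:I^r\to\mathbb{R}^2$, that is, $G^r=\{(x,f^r(x)):x\in I^r\}$ (with $\mathbb{R}\times\mathbb{R}^2$ identified with $\mathbb{R}^3$), such that $f^r(x_n^r)=(y_n^r,z_n^r)$ for all $n=0,1,\dots,N^r$. Moreover, writing $f^r=(f_1^r,f_2^r)$, the projection of $G^r$ onto $\mathbb{R}^2$ given by $(x,y,z)\mapsto(x,y)$ is the graph $\{(x,f_1^r(x)):x\in I^r\}$ of the continuous function $f_1^r:I^r\to\mathbb{R}$, which satisfies $f_1^r(x_n^r)=y_n^r$ for all $n=0,1,\dots,N^r$.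
   Context: Data. Let $N,M\ge 2$ be integers and put $N^1=N$, $N^2=M$. Two generalized data sets of points in $\mathbb{R}^3$ are given: $$\mathcal{D}^1=\{(x_i^1,y_i^1,z_i^1): i=0,\dots,N\},\qquad \mathcal{D}^2=\{(x_j^2,y_j^2,z_j^2): j=0,\dots,M\},$$ with $x_0^1<x_1^1<\dots<x_N^1$ and $x_0^2<x_1^2<\dots<x_M^2$ (the $z_i^1,z_j^2$ are arbitrary real parameters added to the planar data $(x_i^1,y_i^1)$, $(x_j^2,y_j^2)$). Write $I^1=[x_0^1,x_N^1]$ and $I^2=[x_0^2,x_M^2]$. It is assumed that $$\frac{x_i^1-x_{i-1}^1}{x_M^2-x_0^2}<1\quad\text{and}\quad \frac{x_j^2-x_{j-1}^2}{x_N^1-x_0^1}<1$$ for all $i=1,\dots,N$ and $j=1,\dots,M$. Graph. A directed graph with vertex set $V=\{1,2\}$ is given, with $K^{rs}$ edges from $r$ to $s$ ($r,s\in V$), where $K^{11}+K^{12}=N$ and $K^{21}+K^{22}=M$. Maps. For $r,s\in\{1,2\}$ and $n=1,\dots,K^{rs}$, real parameters $\alpha_n^{rs},\beta_n^{rs},\gamma_n^{rs}$ are given, and $w_n^{rs}:\mathbb{R}^3\to\mathbb{R}^3$ is the map $$w_n^{rs}(x,y,z)=\bigl(a_n^{rs}x+b_n^{rs},\ \alpha_n^{rs}y+\beta_n^{rs}z+c_n^{rs}x+d_n^{rs},\ \gamma_n^{rs}z+e_n^{rs}x+f_n^{rs}\bigr),$$ where the real constants $a_n^{rs},b_n^{rs},c_n^{rs},d_n^{rs},e_n^{rs},f_n^{rs}$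 are uniquely determined by the following endpoint conditions: - $w_n^{11}(x_0^1,y_0^1,z_0^1)=(x_{n-1}^1,y_{n-1}^1,z_{n-1}^1)$ and $w_n^{11}(x_N^1,y_N^1,z_N^1)=(x_n^1,y_n^1,z_n^1)$ for $n=1,\dots,K^{11}$; - $w_{n-K^{11}}^{12}(x_0^2,y_0^2,z_0^2)=(x_{n-1}^1,y_{n-1}^1,z_{n-1}^1)$ and $w_{n-K^{11}}^{12}(x_M^2,y_M^2,z_M^2)=(x_n^1,y_n^1,z_n^1)$ for $n=K^{11}+1,\dots,N$; - $w_n^{21}(x_0^1,y_0^1,z_0^1)=(x_{n-1}^2,y_{n-1}^2,z_{n-1}^2)$ and $w_n^{21}(x_N^1,y_N^1,z_N^1)=(x_n^2,y_n^2,z_n^2)$ for $n=1,\dots,K^{21}$; - $w_{n-K^{21}}^{22}(x_0^2,y_0^2,z_0^2)=(x_{n-1}^2,y_{n-1}^2,z_{n-1}^2)$ and $w_{n-K^{21}}^{22}(x_M^2,y_M^2,z_M^2)=(x_n^2,y_n^2,z_n^2)$ for $n=K^{21}+1,\dots,M$. The collection of these maps is the generalized graph-directed iterated function system (GDIFS) associated with $\mathcal{D}^1,\mathcal{D}^2$ and realizing the graph. The function $f_1^r$ is called a coalescence hidden-variable fractal interpolation function (CHFIF). *)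

(* Defs.v *)
From HB Require Import structures.
From mathcomp Require Import all_boot all_order all_algebra.
From mathcomp Require Import all_classical all_reals all_analysis.
Set Implicit Arguments.
Unset Strict Implicit.
Unset Printing Implicit Defensive.
Import Order.TTheory GRing.Theory Num.Theory.
Import numFieldNormedType.Exports.
Local Open Scope classical_set_scope.
Local Open Scope ring_scope.

Inductive vertex : Type := v1 | v2.

(* A generalized data set over each vertex is given by sequences indexed by
   nat; only the entries with index at most [N r] are ever used. *)
Definition data_pt (R : realType) (x y z : vertex -> nat -> R)
    (r : vertex) (n : nat) : R * R * R :=
  (x r n, y r n, z r n).

Definition generalized_data (R : realType) (N : vertex -> nat)
    (x : vertex -> nat -> R) : Prop :=
  [/\ forall r, (2 <= N r)%N,
      forall r i, (i < N r)%N -> x r i < x r i.+1,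
      forall i, (1 <= i <= N v1)%N ->
        (x v1 i - x v1 i.-1) / (x v2 (N v2) - x v2 0%N) < 1
    & forall j, (1 <= j <= N v2)%N ->
        (x v2 j - x v2 j.-1) / (x v1 (N v1) - x v1 0%N) < 1].

Definition hv_affine (R : realType) (alpha beta gamma a b c d e f : R)
    (p : R * R * R) : R * R * R :=
  let: (x, y, z) := p in
  (a * x + b,
   alpha * y + beta * z + c * x + d,
   gamma * z + e * x + f).

Definition maps_ends (R : realType) (N : vertex -> nat)
    (x y z : vertex -> nat -> R) (g : R * R * R -> R * R * R)
    (s r : vertex) (n : nat) : Prop :=
  g (data_pt x y z s 0) = data_pt x y z r n.-1 /\
  g (data_pt x y z s (N s)) = data_pt x y z r n.

(* The edges from [r] to [s] are numbered 1, ..., [K r s]. The constants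
   a, ..., f of each map need not be named: as [x s 0 != x s (N s)], the
   endpoint conditions determine them. *)
Definition gdifs (R : realType) (N : vertex -> nat)
    (K : vertex -> vertex -> nat) (x y z : vertex -> nat -> R)
    (alpha beta gamma : vertex -> vertex -> nat -> R)
    (w : vertex -> vertex -> nat -> R * R * R -> R * R * R) : Prop :=
  [/\ forall r, (K r v1 + K r v2)%N = N r,
      forall r s n, (1 <= n <= K r s)%N ->
        exists a b c d e f : R, forall p,
          w r s n p =
          hv_affine (alpha r s n) (beta r s n) (gamma r s n) a b c d e f p,
      forall r n, (1 <= n <= K r v1)%N ->
        maps_ends N x y z (w r v1 n) v1 r n
    & forall r n, (K r v1 + 1 <= n <= N r)%N ->
        maps_ends N x y z (w r v2 (n - K r v1)%N) v2 r n].

Definition attractors (R : realType) (K : vertex -> vertex -> nat)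
    (w : vertex -> vertex -> nat -> R * R * R -> R * R * R)
    (G : vertex -> set (R * R * R)) : Prop :=
  forall r, [/\ G r !=set0, compact (G r)
    & G r = \bigcup_s \bigcup_(n in [set n | (1 <= n <= K r s)%N])
              (w r s n @` G s)].

(* Main.v *)
Require Import Defs.
From HB Require Import structures.
From mathcomp Require Import all_boot all_order all_algebra.
From mathcomp Require Import all_classical all_reals all_analysis.
From mathcomp Require Import zify ring lra.
Import Order.TTheory GRing.Theory Num.Theory.
Import numFieldNormedType.Exports.
Local Open Scope classical_set_scope.
Local Open Scope ring_scope.

(** The argument works directly with the compact sets [G r] and never builds
    the interpolation function as a fixed point of an operator. Everything
    rests on one principle ([contraction_le0]): a function that is bounded
    above and whose value at each point is nonpositive, or at most a fixed
    [C < 1] times its value at some other point, is nonpositive.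

    In the first coordinate, the maps act as increasing affine contractions
    of ratio [ratio r s m], carrying the interval over [s] onto a cell
    between two consecutive knots over [r]. Hence the projection of [G r]
    lies in the interval (its excess beyond an endpoint contracts,
    [attractor_fst_range]) and fills it (an approximation of a point improves
    by the factor [C] at each step and the projection is closed,
    [attractor_fst_surj]).

    In the vertical direction, two points with the same abscissa are mapped to
    two points with the same abscissa, whose z-gap is multiplied by [gamma]
    and, once the z-gaps vanish, whose y-gap is multiplied by [alpha]. So any
    bounded family of such pairs that is carried backwards by the maps
    consists of equal points ([fiber_collapse]). This is used twice. Applied
    to a point of [G r] over a knot together with the data point at that
    knot, it shows that the fibres over the knots are the data points
    ([attractor_knot]). Adjacent cells share just a knot, so two points of
    [G r] with the same abscissa either come from the same map or lie over a
    knot, where they coincide; thus pairs in the same fibre are carried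
    backwards, and all fibres are singletons ([attractor_fst_inj]).

    Therefore [G r] is the graph of a function, which is continuous because
    its graph is compact ([compact_factor_continuous]), and interpolates the
    data by [attractor_knot]. *)

(** * Contraction and compactness *)

Lemma expr_mul_lt {R : realType} (C B e : R) :
  0 <= C < 1 -> 0 < e -> exists n, C ^+ n * B < e.
Proof.
move=> /andP[C0 C1] e0.
have : geometric B C n @[n --> \oo] --> (0 : R).
  by apply: cvg_geometric; rewrite ger0_norm.
move=> /cvgrPdist_lt /(_ e e0) [n _ /(_ n (leqnn n))] /=.
by rewrite sub0r normrN mulrC => /(le_lt_trans (ler_norm _)) h; exists n.
Qed.

Lemma contraction_le0 {R : realType} {T : Type} (A : set T) (phi : T -> R)
    (B C : R) : 0 <= C < 1 -> (forall p, A p -> phi p <= B) ->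
  (forall p, A p -> phi p <= 0 \/ exists2 q, A q & phi p <= C * phi q) ->
  forall p, A p -> phi p <= 0.
Proof.
move=> C01 phiB phiC; have /andP[C0 _] := C01.
have bnd n : forall p, A p -> phi p <= C ^+ n * `|B|.
  elim: n => [|n IHn] p Ap.
    by rewrite expr0 mul1r (le_trans (phiB _ Ap)) ?ler_norm.
  have [le0|[q Aq le]] := phiC _ Ap.
    by rewrite (le_trans le0) // mulr_ge0 ?exprn_ge0.
  by rewrite (le_trans le) // exprS -mulrA ler_wpM2l ?IHn.
move=> p Ap; rewrite leNgt; apply/negP => phi0.
have [n] := expr_mul_lt C `|B| _ C01 phi0.
by rewrite ltNge bnd.
Qed.

Lemma finite_lt_bound {R : realType} (c : R) (F : nat -> R) (n : nat) :
  (forall i, (i < n)%N -> F i < c) ->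
  exists2 C, C < c & forall i, (i < n)%N -> F i <= C.
Proof.
elim: n => [_|n IHn Fc]; first by exists (c - 1) => //; lra.
have [i|C Cc FC] := IHn; first by move=> ilt; apply: Fc; lia.
exists (Num.max C (F n)); first by rewrite gt_max Cc Fc.
move=> i; rewrite ltnS leq_eqVlt => /predU1P[->|ilt].
  by rewrite le_max lexx orbT.
by rewrite le_max FC.
Qed.

(** A function [f] is continuous on [A] as soon as [f \o pi] agrees with a
    continuous function on a compact set whose image under the continuous map
    [pi] covers [A]: the points of [A] that [f] sends outside an open set lie
    in the image of a compact subset of [P], which is closed. *)
Lemma compact_factor_continuous {T U V : topologicalType} (P : set V)
    (pi : V -> T) (g : V -> U) (f : T -> U) (A : set T) :
  hausdorff_space T -> compact P -> continuous pi -> continuous g ->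
  (forall v, P v -> g v = f (pi v)) -> A `<=` pi @` P ->
  {within A, continuous f}.
Proof.
move=> hT cP cpi cg gf AP; apply/subspace_continuousP => t At.
move=> W; rewrite nbhsE => -[B [oB Bft] BW].
have cQ : compact (P `&` (g @^-1` (~` B))).
  apply: compact_closedI => //; apply: preimage_closed => //.
  exact: open_closedC.
have clQ : closed (pi @` (P `&` (g @^-1` (~` B)))).
  apply: compact_closed => //; apply: continuous_compact => //.
  exact: continuous_subspaceT.
have tQ : (~` (pi @` (P `&` (g @^-1` (~` B))))) t.
  by move=> [v [Pv /= nB] vt]; apply: nB; rewrite gf // vt.
have : nbhs t (~` (pi @` (P `&` (g @^-1` (~` B))))).
  by apply: open_nbhs_nbhs; split => //; exact: closed_openC.
apply: filterS => s sQ As; apply: BW; apply: contrapT => nB; apply: sQ.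
by have [v Pv vs] := AP _ As; exists v => //; split => //=; rewrite gf // vs.
Qed.

Lemma sum_norm_bound {R : realType} (F : nat -> R) (n i : nat) :
  (i <= n)%N -> `|F i| <= \sum_(j < n.+1) `|F j|.
Proof.
move=> ilt; have ilt' : (i < n.+1)%N by [].
rewrite (bigD1 (Ordinal ilt')) //= lerDl; exact: sumr_ge0.
Qed.

(** * Geometry of the edge maps *)

Section Attractor.
Context {R : realType} {N : vertex -> nat} {K : vertex -> vertex -> nat}.
Context {x y z : vertex -> nat -> R}.
Context {alpha beta gamma : vertex -> vertex -> nat -> R}.
Context {w : vertex -> vertex -> nat -> R * R * R -> R * R * R}.
Context {G : vertex -> set (R * R * R)}.
Hypothesis hdata : generalized_data N x.
Hypothesis hw : gdifs N K x y z alpha beta gamma w.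
Hypothesis hpar : forall r s n, (1 <= n <= K r s)%N ->
  [/\ `|alpha r s n| < 1, `|gamma r s n| < 1
    & `|beta r s n| + `|gamma r s n| < 1].
Hypothesis hG : attractors K w G.

Notation edge r s m := (1 <= m <= K r s)%N.

(** The index of the cell over [r], between the knots [slot r s m - 1] and
    [slot r s m], onto which the [m]-th edge from [r] to [s] maps: the edges
    to [v1] come first, followed by those to [v2]. *)
Definition slot (r s : vertex) (m : nat) : nat :=
  if s is v1 then m else (K r v1 + m)%N.

(** The contraction ratio of an edge map in the first coordinate: the length
    of its cell over the length of the interval that it starts from. *)
Definition ratio (r s : vertex) (m : nat) : R :=
  (x r (slot r s m) - x r (slot r s m).-1) / (x s (N s) - x s 0%N).

Lemma slot_bounds r s m : edge r s m -> (1 <= slot r s m <= N r)%N.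
Proof. by have [<- _ _ _] := hw; rewrite /slot; case: s; lia. Qed.

Lemma slot_surj r n : (1 <= n <= N r)%N ->
  exists s m, edge r s m /\ slot r s m = n.
Proof.
have [<- _ _ _] := hw => nN; have [nK|nK] := leqP n (K r v1).
  by exists v1, n; split => //; lia.
by exists v2, (n - K r v1)%N => /=; split; lia.
Qed.

Lemma slot_inj r s m s' m' : edge r s m -> edge r s' m' ->
  slot r s m = slot r s' m' -> s = s' /\ m = m'.
Proof. by rewrite /slot; case: s; case: s' => *; split => //; lia. Qed.

Lemma knot_lt r i j : (i < j <= N r)%N -> x r i < x r j.
Proof.
have [_ xlt _ _] := hdata; elim: j => [|j IHj]; first lia.
rewrite ltnS => /andP[]; rewrite leq_eqVlt => /predU1P[->|ij] jN.
  exact: xlt.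
by apply: lt_trans (xlt _ _ jN); apply: IHj; lia.
Qed.

Lemma knot_le r i j : (i <= j <= N r)%N -> x r i <= x r j.
Proof.
rewrite leq_eqVlt => /andP[/predU1P[->//|ij] jN].
by apply/ltW/knot_lt; rewrite ij.
Qed.

Lemma knot_first_last r : x r 0%N < x r (N r).
Proof. by have [N2 _ _ _] := hdata; apply: knot_lt; have := N2 r; lia. Qed.

Lemma ratio_gt0 r s m : edge r s m -> 0 < ratio r s m.
Proof.
move=> /slot_bounds krm; have := knot_first_last s => xs.
by rewrite divr_gt0 ?subr_gt0 // knot_lt //; lia.
Qed.

(** Between distinct vertices this is assumed of the data; over a single
    vertex it holds because there are at least two cells. *)
Lemma ratio_lt1 r s m : edge r s m -> ratio r s m < 1.
Proof.
move=> /slot_bounds; rewrite /ratio; move: (slot r s m) => n nN.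
have [N2 _ h1 h2] := hdata; have xs := knot_first_last s.
have self : r = s -> (x r n - x r n.-1) / (x s (N s) - x s 0%N) < 1.
  move=> rs; subst s; rewrite ltr_pdivrMr ?subr_gt0 // mul1r.
  have le0 : x r 0%N <= x r n.-1 by apply: knot_le; lia.
  have leN : x r n <= x r (N r) by apply: knot_le; lia.
  have [n1|n1] := eqVneq n 1%N.
    have : x r n < x r (N r) by apply: knot_lt; have := N2 r; lia.
    by lra.
  have : x r 0%N < x r n.-1 by apply: knot_lt; lia.
  by lra.
by case: r s nN self {xs} => [] [] nN self;
  [exact: self|exact: h1|exact: h2|exact: self].
Qed.

Lemma edge_maps_ends r s m : edge r s m ->
  maps_ends N x y z (w r s m) s r (slot r s m).
Proof.
move=> e; have := slot_bounds _ _ _ e; have [_ _ e1 e2] := hw.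
case: s e => /= e kN; first exact: e1.
by have := e2 r (K r v1 + m)%N; rewrite addKn; apply; lia.
Qed.

Lemma edge_fst r s m p : edge r s m ->
  (w r s m p).1.1 = x r (slot r s m).-1 + ratio r s m * (p.1.1 - x s 0%N).
Proof.
move=> e; have [] := edge_maps_ends _ _ _ e; have [_ hv _ _] := hw.
have [a [b [c [d [e' [f wE]]]]]] := hv _ _ _ e.
have xs := knot_first_last s; have nz : x s (N s) - x s 0%N != 0 by lra.
rewrite !wE /data_pt /hv_affine /ratio => -[h0 _ _] [hN _ _].
case: p => [[X Y] Z] /=; rewrite -hN -h0; field.
by [].
Qed.

Lemma edge_fstN r s m p : edge r s m ->
  (w r s m p).1.1 = x r (slot r s m) - ratio r s m * (x s (N s) - p.1.1).
Proof.
move=> e; rewrite edge_fst // /ratio.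
have xs := knot_first_last s; have nz : x s (N s) - x s 0%N != 0 by lra.
by field.
Qed.

Lemma edge_vertical r s m p q : edge r s m -> p.1.1 = q.1.1 ->
  (w r s m p).1.2 - (w r s m q).1.2 =
    alpha r s m * (p.1.2 - q.1.2) + beta r s m * (p.2 - q.2) /\
  (w r s m p).2 - (w r s m q).2 = gamma r s m * (p.2 - q.2).
Proof.
move=> e; have [_ hv _ _] := hw.
have [a [b [c [d [e' [f wE]]]]]] := hv _ _ _ e; rewrite !wE.
by case: p q => [[X Y] Z] [[X' Y'] Z'] /= ->; split; ring.
Qed.

(** There are finitely many edges, so contraction factors are uniform. *)
Lemma edge_bound (F : vertex -> vertex -> nat -> R) :
  (forall r s m, edge r s m -> F r s m < 1) ->
  exists2 C, 0 <= C < 1 & forall r s m, edge r s m -> F r s m <= C.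
Proof.
move=> F1.
have row r s : exists2 C, C < 1 & forall m, edge r s m -> F r s m <= C.
  have [i iK|C C1 FC] := finite_lt_bound 1 (fun i => F r s i.+1) (K r s).
    exact: F1.
  by exists C => // -[//|m] mK; apply: FC.
have [C11 C11_1 F11] := row v1 v1; have [C12 C12_1 F12] := row v1 v2.
have [C21 C21_1 F21] := row v2 v1; have [C22 C22_1 F22] := row v2 v2.
exists (Num.max 0 (Num.max (Num.max C11 C12) (Num.max C21 C22))).
  by rewrite le_max lexx !gt_max C11_1 C12_1 C21_1 C22_1 ltr01.
by move=> [] [] m /[dup] /[swap] _ ?; rewrite !le_max ?F11 ?F12 ?F21 ?F22 ?orbT.
Qed.

Lemma attractor_edge r p : G r p ->
  exists s m q, [/\ edge r s m, G s q & p = w r s m q].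
Proof.
have [_ _ {1}->] := hG r => -[s _ [m mK [q Gq <-]]].
by exists s, m, q; split.
Qed.

Lemma edge_attractor r s m q : edge r s m -> G s q -> G r (w r s m q).
Proof.
by move=> e Gq; have [_ _ ->] := hG r; exists s => //; exists m => //; exists q.
Qed.

Lemma attractor_bounded : exists B, forall r p, G r p ->
  [/\ `|p.1.1| <= B, `|p.1.2| <= B & `|p.2| <= B].
Proof.
have one r : exists B, forall p, G r p -> `|p| <= B.
  have [_ /compact_bounded [B [_ GB]] _] := hG r.
  by exists (B + 1) => p; apply: GB; rewrite ltrDl.
have [B1 GB1] := one v1; have [B2 GB2] := one v2.
exists (Num.max B1 B2) => r p Gp.
have : `|p| <= Num.max B1 B2.
  by rewrite le_max; case: r Gp => [/GB1|/GB2] ->; rewrite ?orbT.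
by rewrite !prod_normE /= !ge_max => /andP[/andP[-> ->] ->].
Qed.

(** * The projection onto the first coordinate *)

(** The form of [contraction_le0] for quantities which, along an edge map, are
    scaled at most by its ratio; used for the excess of a point beyond either
    end of the interval. *)
Lemma attractor_ratio_le0 (phi : vertex -> R * R * R -> R) :
  (exists B, forall r p, G r p -> phi r p <= B) ->
  (forall r s m q, edge r s m -> phi r (w r s m q) <= ratio r s m * phi s q) ->
  forall r p, G r p -> phi r p <= 0.
Proof.
move=> [B phiB] phiw; have [C C01 ratioC] := edge_bound ratio ratio_lt1.
move=> r p Gp.
apply: (contraction_le0 [set u | G u.1 u.2] (fun u => phi u.1 u.2) B C C01 _ _
  (r, p) Gp) => [[r' p'] /= /phiB //|[r' p'] /= Gp'].
have [s [m [q [e Gq ->]]]] := attractor_edge _ _ Gp'.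
have rho0 := ratio_gt0 _ _ _ e; have le := phiw _ _ _ q e.
have [phi0|phi0] := leP (phi s q) 0; [left|right].
  by apply: le_trans le _; rewrite pmulr_rle0.
exists (s, q) => //=; apply: le_trans le _.
by rewrite ler_wpM2r ?ratioC // ltW.
Qed.

Lemma attractor_fst_range r p : G r p -> x r 0%N <= p.1.1 <= x r (N r).
Proof.
move=> Gp; have [B GB] := attractor_bounded; apply/andP; split.
  rewrite -subr_le0; apply: (attractor_ratio_le0
    (fun r p => x r 0%N - p.1.1) _ _ r p Gp) => [|r' s m q e].
    exists (B + (`|x v1 0%N| + `|x v2 0%N|)) => r' q /GB [+ _ _].
    rewrite ler_norml => /andP[qB _].
    have n1 := ler_norm (x v1 0%N); have n2 := ler_norm (x v2 0%N).
    have p1 := normr_ge0 (x v1 0%N); have p2 := normr_ge0 (x v2 0%N).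
    by case: r' => //=; lra.
  have : x r' 0%N <= x r' (slot r' s m).-1.
    by have := slot_bounds _ _ _ e => ?; apply: knot_le; lia.
  by rewrite edge_fst //; lra.
rewrite -subr_le0; apply: (attractor_ratio_le0
  (fun r p => p.1.1 - x r (N r)) _ _ r p Gp) => [|r' s m q e].
  exists (B + (`|x v1 (N v1)| + `|x v2 (N v2)|)) => r' q /GB [+ _ _].
  rewrite ler_norml => /andP[_ qB].
  have := ler_norm (- x v1 (N v1)); have := ler_norm (- x v2 (N v2)).
  rewrite !normrN => n1 n2.
  have p1 := normr_ge0 (x v1 (N v1)); have p2 := normr_ge0 (x v2 (N v2)).
  by case: r' => //=; lra.
have : x r' (slot r' s m) <= x r' (N r').
  by have := slot_bounds _ _ _ e => ?; apply: knot_le; lia.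
by rewrite edge_fstN //; lra.
Qed.

Lemma knot_cell r t : x r 0%N <= t <= x r (N r) ->
  exists n, [/\ (1 <= n <= N r)%N, x r n.-1 <= t & t <= x r n].
Proof.
move=> /andP[t0 tN].
suff cell j : (j <= N r)%N -> t <= x r j -> (0 < j)%N ->
    exists n, [/\ (1 <= n <= N r)%N, x r n.-1 <= t & t <= x r n].
  by apply: (cell (N r)) => //; have [N2 _ _ _] := hdata; have := N2 r; lia.
elim: j => // j IHj jN tj _.
have [tlt|tge] := ltP t (x r j); last by exists j.+1; split.
apply: IHj; [lia|exact: ltW|].
by case: j tlt {jN tj} => //; rewrite ltNge t0.
Qed.

(** By self-similarity, the points of the interval are within [C ^+ n * B] of
    the projection, for each [n]: pull the point back to the interval over
    the vertex where its cell comes from, and approximate there. *)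
Lemma attractor_fst_approx (C : R) : 0 <= C ->
  (forall r s m, edge r s m -> ratio r s m <= C) ->
  exists B, forall n r t, x r 0%N <= t <= x r (N r) ->
    exists2 p, G r p & `|t - p.1.1| <= C ^+ n * B.
Proof.
move=> C0 ratioC.
exists ((x v1 (N v1) - x v1 0%N) + (x v2 (N v2) - x v2 0%N)).
elim=> [|n IHn] r t trange.
  have [[p Gp] _ _] := hG r; exists p => //.
  have := attractor_fst_range _ _ Gp; have l1 := knot_first_last v1.
  have l2 := knot_first_last v2; rewrite expr0 mul1r ler_norml.
  by case: r trange {Gp} => /=; lra.
have [k [kN tk tk']] := knot_cell _ _ trange.
have [s [m [e sk]]] := slot_surj _ _ kN; subst k.
have rho0 := ratio_gt0 _ _ _ e.
(* [t'] is the preimage of [t] under the edge map onto its cell. *)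
pose t' := x s 0%N + (t - x r (slot r s m).-1) / ratio r s m.
have tE : t = x r (slot r s m).-1 + ratio r s m * (t' - x s 0%N).
  by rewrite /t'; field; rewrite gt_eqF.
have xs := knot_first_last s.
have knotE : x r (slot r s m) =
    x r (slot r s m).-1 + ratio r s m * (x s (N s) - x s 0%N).
  by rewrite /ratio; field; rewrite subr_eq0 gt_eqF.
have t'range : x s 0%N <= t' <= x s (N s).
  apply/andP; split.
    by rewrite /t' lerDl; apply: divr_ge0; rewrite ?subr_ge0 // ltW.
  move: tk'; rewrite {1}tE knotE lerD2l ler_pM2l //; lra.
have [q Gq qle] := IHn _ _ t'range.
exists (w r s m q); first exact: edge_attractor.
rewrite edge_fst // {1}tE.
have -> : x r (slot r s m).-1 + ratio r s m * (t' - x s 0%N) -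
  (x r (slot r s m).-1 + ratio r s m * (q.1.1 - x s 0%N)) =
  ratio r s m * (t' - q.1.1) by ring.
rewrite normrM gtr0_norm // exprS -mulrA.
by apply: ler_pM => //; [exact: ltW|exact: ratioC].
Qed.

Lemma attractor_fst_surj r t : x r 0%N <= t <= x r (N r) ->
  exists2 p, G r p & p.1.1 = t.
Proof.
move=> trange; have [C C01 ratioC] := edge_bound ratio ratio_lt1.
have [B approx] := attractor_fst_approx _ (proj1 (andP C01)) ratioC.
have clX : closed [set p.1.1 | p in G r].
  apply: compact_closed; first exact: Rhausdorff.
  have [_ cG _] := hG r; apply: continuous_compact => //.
  apply: continuous_subspaceT => p.
  apply: (@cvg_comp _ _ _ fst fst _ (nbhs p.1)); exact: cvg_fst.
suff /clX [p Gp <-] : closure [set p.1.1 | p in G r] t by exists p.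
move=> W /nbhs_ballP [eps /= eps0 epsW].
have [n nB] := expr_mul_lt C B eps C01 eps0.
have [p Gp ple] := approx n r t trange.
exists p.1.1; split; first by exists p.
by apply: epsW; rewrite /ball /= (le_lt_trans ple).
Qed.

(** * Fibres of the attractors *)

(** If [A] relates pairs of points in the same fibre, with bounded gaps, and
    each pair of distinct points is the image of a pair of [A] under an edge
    map, then the pairs of [A] consist of equal points. *)
Lemma fiber_collapse (A : vertex -> R * R * R -> R * R * R -> Prop) :
  (exists B, forall r p q, A r p q ->
    `|p.1.2 - q.1.2| <= B /\ `|p.2 - q.2| <= B) ->
  (forall r p q, A r p q -> p.1.1 = q.1.1) ->
  (forall r p q, A r p q -> p = q \/
    exists s m p' q', [/\ edge r s m, A s p' q', p = w r s m p'
      & q = w r s m q']) ->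
  forall r p q, A r p q -> p = q.
Proof.
move=> [B AB] Afst Aedge.
have [Cz Cz01 gammaC] : exists2 C, 0 <= C < 1 &
    forall r s m, edge r s m -> `|gamma r s m| <= C.
  by apply: edge_bound => r s m /hpar[].
have [Cy Cy01 alphaC] : exists2 C, 0 <= C < 1 &
    forall r s m, edge r s m -> `|alpha r s m| <= C.
  by apply: edge_bound => r s m /hpar[].
pose D := [set u : vertex * (R * R * R) * (R * R * R) | A u.1.1 u.1.2 u.2].
have Dz u : D u -> `|u.1.2.2 - u.2.2| <= 0.
  apply: (contraction_le0 D (fun u => `|u.1.2.2 - u.2.2|) B Cz) => //.
    by move=> v /AB[].
  move=> [[r p] q] /= /[dup] Apq /Aedge /=.
  move=> [->|[s [m [p' [q' [e Apq' -> ->]]]]]].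
    by left; rewrite subrr normr0.
  right; exists (s, p', q') => //=.
  have [_ ->] := edge_vertical r s m p' q' e (Afst _ _ _ Apq').
  by rewrite normrM ler_wpM2r ?gammaC.
(* The y-gap contracts only up to a multiple of the z-gap, hence the
   vanishing of the z-gaps is needed first. *)
have Az r p q : A r p q -> p.2 = q.2.
  move=> Apq; apply/eqP; rewrite -subr_eq0 -normr_le0.
  exact: (Dz (r, p, q)).
have Dy u : D u -> `|u.1.2.1.2 - u.2.1.2| <= 0.
  apply: (contraction_le0 D (fun u => `|u.1.2.1.2 - u.2.1.2|) B Cy) => //.
    by move=> v /AB[].
  move=> [[r p] q] /= /[dup] Apq /Aedge /=.
  move=> [->|[s [m [p' [q' [e Apq' -> ->]]]]]].
    by left; rewrite subrr normr0.
  right; exists (s, p', q') => //=.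
  have [-> _] := edge_vertical r s m p' q' e (Afst _ _ _ Apq').
  by rewrite (Az _ _ _ Apq') subrr mulr0 addr0 normrM ler_wpM2r ?alphaC.
move=> r p q Apq.
have : p.1.2 = q.1.2.
  apply/eqP; rewrite -subr_eq0 -normr_le0.
  exact: (Dy (r, p, q)).
move: (Afst _ _ _ Apq) (Az _ _ _ Apq).
by case: p q {Apq} => [[X Y] Z] [[X' Y'] Z'] /= -> -> ->.
Qed.

Lemma edge_cell r s m q : edge r s m -> G s q ->
  x r (slot r s m).-1 <= (w r s m q).1.1 <= x r (slot r s m).
Proof.
move=> e /attractor_fst_range /andP[q0 qN]; have rho0 := ratio_gt0 _ _ _ e.
rewrite {1}edge_fst // edge_fstN // lerDl gerBl.
by apply/andP; split; rewrite mulr_ge0 ?subr_ge0 // ltW.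
Qed.

Lemma knot_values_bounded (v : vertex -> nat -> R) :
  exists B, forall r i, (i <= N r)%N -> `|v r i| <= B.
Proof.
exists (\sum_(j < (N v1).+1) `|v v1 j| + \sum_(j < (N v2).+1) `|v v2 j|).
move=> r i iN; apply: le_trans (sum_norm_bound (v r) (N r) i iN) _.
by case: r {iN}; rewrite ?lerDl ?lerDr; apply: sumr_ge0.
Qed.

(** [fiber_collapse] applies to pairs formed by a point of the attractor over a
    knot and the data point there. A knot in the cell of an edge is one of the
    two ends of that cell, so it comes from an end of the interval that the
    edge starts from, and the point and the data point both come from points
    over that end. *)
Lemma attractor_knot r p n : G r p -> (n <= N r)%N -> p.1.1 = x r n ->
  p = data_pt x y z r n.
Proof.
move=> Gp nN pn.
apply: (fiber_collapse (fun r p q => G r p /\ exists n,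
  [/\ (n <= N r)%N, p.1.1 = x r n & q = data_pt x y z r n]) _ _ _ r);
  last 1 first.
- by split => //; exists n; split.
- have [B GB] := attractor_bounded.
  have [By yB] := knot_values_bounded y; have [Bz zB] := knot_values_bounded z.
  exists (B + (By + Bz)) => r' p' q' [/GB[_ pB1 pB2] [i [iN _ ->]]] /=.
  have yi := yB _ _ iN; have zi := zB _ _ iN.
  have y0 := normr_ge0 (y r' i); have z0 := normr_ge0 (z r' i).
  by split; apply: le_trans (ler_normB _ _) _; apply: lerD => //; lra.
- by move=> r' p' q' [_ [i [_ -> ->]]].
move=> r' p' q' [Gp' [i [iN pi ->]]]; right.
have [s [m [q [e Gq pE]]]] := attractor_edge _ _ Gp'; subst p'.
have := edge_cell _ _ _ _ e Gq; rewrite pi => /andP[kle lek].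
have kN := slot_bounds _ _ _ e; have [h0 hN] := edge_maps_ends _ _ _ e.
have rho0 := ratio_gt0 _ _ _ e.
have [ik|ik] : i = (slot r' s m).-1 \/ i = slot r' s m.
  have [ki|ik] := ltnP (slot r' s m) i.
    have lt : x r' (slot r' s m) < x r' i by apply: knot_lt; lia.
    by have := lt_le_trans lt lek; rewrite ltxx.
  have [ik'|ki] := ltnP i (slot r' s m).-1; last by lia.
  have lt : x r' i < x r' (slot r' s m).-1 by apply: knot_lt; lia.
  by have := lt_le_trans lt kle; rewrite ltxx.
- exists s, m, q, (data_pt x y z s 0%N); split => //; last by rewrite h0 ik.
  split => //; exists 0%N; split => //.
  move: pi; rewrite edge_fst // ik => /eqP.
  by rewrite -subr_eq0 addrAC subrr add0r mulf_eq0 gt_eqF //= subr_eq0 => /eqP.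
- exists s, m, q, (data_pt x y z s (N s)); split => //; last by rewrite hN ik.
  split => //; exists (N s); split => //.
  move: pi; rewrite edge_fstN // ik => /eqP.
  rewrite -subr_eq0 addrAC subrr add0r oppr_eq0 mulf_eq0 gt_eqF //= subr_eq0.
  by move=> /eqP.
Qed.

(** Points of distinct cells with the same abscissa coincide, because they lie
    over a knot. *)
Lemma edge_distinct_cells_eq r s m s' m' p q :
  edge r s m -> edge r s' m' -> G s p -> G s' q ->
  (w r s m p).1.1 = (w r s' m' q).1.1 ->
  (slot r s m < slot r s' m')%N -> w r s m p = w r s' m' q.
Proof.
move=> e e' Gp Gq pq kk'; have kN := slot_bounds _ _ _ e.
have k'N := slot_bounds _ _ _ e'.
have /andP[_ pk] := edge_cell _ _ _ _ e Gp.
have /andP[kq _] := edge_cell _ _ _ _ e' Gq.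
have kk : x r (slot r s m) <= x r (slot r s' m').-1 by apply: knot_le; lia.
(* Both points are over the right end of the cell [slot r s m]. *)
have pE : (w r s m p).1.1 = x r (slot r s m) by lra.
have mN : (slot r s m <= N r)%N by lia.
rewrite (attractor_knot r (w r s m p) _ _ mN pE); last exact: edge_attractor.
apply/esym/(attractor_knot _ _ _ _ mN); first exact: edge_attractor.
by rewrite -pq.
Qed.

Lemma attractor_fst_inj r p q : G r p -> G r q -> p.1.1 = q.1.1 -> p = q.
Proof.
move=> Gp Gq pq.
apply: (fiber_collapse (fun r p q => [/\ G r p, G r q & p.1.1 = q.1.1])
  _ _ _ r) => //.
- have [B GB] := attractor_bounded.
  exists (B + B) => r' p' q' [/GB[_ p1 p2] /GB[_ q1 q2] _].
  by split; apply: le_trans (ler_normB _ _) _; apply: lerD.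
- by move=> r' p' q' [].
move=> {}r {Gp Gq pq}p {}q [Gp Gq pq].
have [s [m [p' [e Gp' pE]]]] := attractor_edge _ _ Gp; subst p.
have [s' [m' [q' [e' Gq' qE]]]] := attractor_edge _ _ Gq; subst q.
case: (ltngtP (slot r s m) (slot r s' m')) => kk'.
- by left; exact: edge_distinct_cells_eq.
- by left; apply/esym; exact: edge_distinct_cells_eq.
have [ss mm] := slot_inj _ _ _ _ _ e e' kk'; subst s' m'.
right; exists s, m, p', q'; split => //; split => //.
move: pq; rewrite !edge_fst // => /addrI /mulfI => /(_ _)/addIr; apply.
by rewrite gt_eqF // ratio_gt0.
Qed.

Lemma attractor_graph r : exists f : R -> R * R,
  {within `[x r 0%N, x r (N r)], continuous f} /\
  G r = [set (t, (f t).1, (f t).2) | t in `[x r 0%N, x r (N r)]].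
Proof.
have [f fE] : exists f : R -> R * R,
    forall p, G r p -> f p.1.1 = (p.1.2, p.2).
  pose g (t : R) := xget (0 : R * R * R) [set p | G r p /\ p.1.1 = t].
  exists (fun t => ((g t).1.2, (g t).2)) => p Gp; rewrite /g.
  case: xgetP => [q _ [Gq qp]|/(_ p)]; last by case.
  by rewrite (attractor_fst_inj r q p).
exists f; split.
  have [_ cG _] := hG r.
  apply: (compact_factor_continuous (G r) (fun p => p.1.1)
    (fun p => (p.1.2, p.2)) f _ (@Rhausdorff R) cG).
  - move=> p; apply: (@cvg_comp _ _ _ fst fst _ (nbhs p.1)); exact: cvg_fst.
  - move=> p; apply: (@cvg_pair _ _ _ _ (nbhs p.1.2) (nbhs p.2)).
      apply: (@cvg_comp _ _ _ fst snd _ (nbhs p.1)); first exact: cvg_fst.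
      exact: cvg_snd.
    exact: cvg_snd.
  - by move=> p /fE.
  move=> t /=; rewrite in_itv /= => /attractor_fst_surj[p Gp <-].
  by exists p.
apply/seteqP; split => [p Gp|_ [t /= + <-]].
  exists p.1.1; first by rewrite /= in_itv /= attractor_fst_range.
  by rewrite /= fE //; case: p Gp => [[]].
rewrite in_itv /= => /attractor_fst_surj[p Gp <-].
by rewrite /= fE //; case: p Gp => [[]].
Qed.

End Attractor.

Theorem theorem3p2 (R : realType) (N : vertex -> nat)
    (K : vertex -> vertex -> nat) (x y z : vertex -> nat -> R)
    (alpha beta gamma : vertex -> vertex -> nat -> R)
    (w : vertex -> vertex -> nat -> R * R * R -> R * R * R)
    (G : vertex -> set (R * R * R))
    (hdata : generalized_data N x)
    (hw : gdifs N K x y z alpha beta gamma w)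
    (hpar : forall r s n, (1 <= n <= K r s)%N ->
      [/\ `|alpha r s n| < 1, `|gamma r s n| < 1
        & `|beta r s n| + `|gamma r s n| < 1])
    (hG : attractors K w G) :
  forall r : vertex, exists f : R -> R * R,
    [/\ {within `[x r 0%N, x r (N r)], continuous f},
        G r = [set (t, (f t).1, (f t).2) | t in `[x r 0%N, x r (N r)]]
      & forall n, (n <= N r)%N -> f (x r n) = (y r n, z r n)] /\
    [/\ {within `[x r 0%N, x r (N r)], continuous (fun t => (f t).1)},
        [set (p.1.1, p.1.2) | p in G r] =
          [set (t, (f t).1) | t in `[x r 0%N, x r (N r)]]
      & forall n, (n <= N r)%N -> (f (x r n)).1 = y r n].
Proof.
move=> r; have [f [fcont GE]] := attractor_graph hdata hw hpar hG r.
have fknot n : (n <= N r)%N -> f (x r n) = (y r n, z r n).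
  move=> nN.
  have Gf : G r (x r n, (f (x r n)).1, (f (x r n)).2).
    rewrite GE; exists (x r n) => //=; rewrite in_itv /=.
    by rewrite !(knot_le hdata) //; lia.
  have := attractor_knot hdata hw hpar hG r _ n Gf nN erefl.
  by case: (f (x r n)) => a b /= [-> ->].
exists f; split; first by split.
split.
- move=> t; apply: (cvg_comp _ _ (fcont t)); exact: cvg_fst.
- rewrite {1}GE; apply/seteqP; split => [_ [_ [t It <-] <-]|_ [t It <-]].
    by exists t.
  by exists (t, (f t).1, (f t).2) => //; exists t.
- by move=> n /fknot ->.
Qed.
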